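(* For every odd number $n\ge 3$, \[\mathcal{P}^{(n)}=\bigcup_{v\in T^{(n)}}\frac{1}{2}\left(v+\mathcal{P}^{(n)}\right),\] where $T^{(n)}=\{(x_1,x_2,\dots,x_n)\in\{0,1\}^n : x_1\oplus x_2\oplus\dots\oplus x_n=0\}$.
   Context: $\mathbb{N}$ denotes the non-negative integers, and $\oplus$ denotes the bitwise exclusive OR (Nim-sum) of non-negative integers. For $m\ge 0$ let \[P_m^{(n)}=\{(x_1,\dots,x_n)\in\mathbb{N}^n : x_i<2^m \text{ for } 1\le i\le n \text{ and } x_1\oplus x_2\oplus\dots\oplus x_n=0\}.\] The scaled sets $\frac{1}{2^m}P_m^{(n)}\subset[0,1)^n$ are increasing in $m$, and \[\mathcal{P}^{(n)}:=\lim_{m\to\infty}\frac{1}{2^m}P_m^{(n)}=\bigcup_{m=0}^{\infty}\frac{1}{2^m}P_m^{(n)}\subset\mathbb{R}^n.\] For $A\subset\mathbb{R}^n$, $v\in\mathbb{R}^n$ and $a\in\mathbb{R}$, $a(v+A):=\{a(v+x) : x\in A\}$. *)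

(* Defs.v *)
From Stdlib Require PeanoNat.
From mathcomp Require Import all_boot all_order all_algebra.
From mathcomp Require Import all_classical all_reals.

Set Implicit Arguments.
Unset Strict Implicit.
Unset Printing Implicit Defensive.

Import GRing.Theory Num.Theory.

Local Open Scope classical_set_scope.
Local Open Scope ring_scope.

Definition nimsum (n : nat) (x : 'rV[nat]_n) : nat :=
  \big[PeanoNat.Nat.lxor/0%N]_(i < n) x ord0 i.

Definition ppos (n m : nat) : set 'rV[nat]_n :=
  [set x : 'rV[nat]_n |
    (forall i, (x ord0 i < 2 ^ m)%N) /\ nimsum x = 0%N].
Arguments ppos n m : clear implicits.

Definition tset (n : nat) : set 'rV[nat]_n :=
  [set x : 'rV[nat]_n |
    (forall i, x ord0 i = 0%N \/ x ord0 i = 1%N) /\ nimsum x = 0%N].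
Arguments tset n : clear implicits.

Definition natmx (R : realType) (n : nat) (x : 'rV[nat]_n) : 'rV[R]_n :=
  map_mx (fun k : nat => k%:R) x.

Definition scaled_translate (R : realType) (n : nat) (a : R) (v : 'rV[R]_n)
    (A : set 'rV[R]_n) : set 'rV[R]_n :=
  [set a *: (v + x) | x in A].

(* The sets (1 / 2 ^ m) P_m increase with m, so their set-theoretic limit is
   their union. *)
Definition plim (R : realType) (n : nat) : set 'rV[R]_n :=
  \bigcup_(m in [set: nat])
    [set (1 / 2 ^+ m) *: natmx R x | x in ppos n m].
Arguments plim R n : clear implicits.

(* Main.v *)
Require Import Defs.
From mathcomp Require Import all_boot all_order all_algebra.
From mathcomp Require Import all_classical all_reals.
From Stdlib Require PeanoNat.
From mathcomp Require Import ring.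

(** Splitting each coordinate [x_i < 2 ^ m.+1] into its leading bit
    [x_i %/ 2 ^ m] and its remainder [x_i %% 2 ^ m] commutes with the Nim-sum,
    so [P_(m+1)] is the set of all [2 ^ m v + y] with [v] in [T] and [y] in
    [P_m]; dividing by [2 ^ m.+1] and taking the union over [m] gives the
    self-similarity. *)

Local Open Scope classical_set_scope.
Local Open Scope ring_scope.

Import GRing.Theory.

(** This lemma and the next two pass to [Nat.pow], [Nat.div] and [Nat.modulo], the operations in
    which the facts about shifts and bits used below are phrased. *)
Lemma expn_pow (a m : nat) : (a ^ m)%N = PeanoNat.Nat.pow a m.
Proof. by elim: m => [|m IHm] //=; rewrite expnS IHm. Qed.

Lemma divn_div (a d : nat) : (0 < d)%N -> (a %/ d)%N = PeanoNat.Nat.div a d.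
Proof.
move=> d_gt0; apply: (PeanoNat.Nat.div_unique a d _ (a %% d)).
  by apply/ltP; rewrite ltn_mod.
by rewrite [LHS](divn_eq a d) mulnC.
Qed.

Lemma modn_modulo (a d : nat) : (0 < d)%N -> (a %% d)%N = PeanoNat.Nat.modulo a d.
Proof.
move=> d_gt0; apply: (PeanoNat.Nat.mod_unique a d (a %/ d)).
  by apply/ltP; rewrite ltn_mod.
by rewrite [LHS](divn_eq a d) mulnC.
Qed.

(** Division by [2 ^ m] is a right shift by [m] bits, and a shift only relabels bit positions. *)
Lemma lxor_divn_exp2 (m : nat) :
  {morph (fun k : nat => k %/ 2 ^ m)%N : a b / PeanoNat.Nat.lxor a b}.
Proof.
move=> a b; rewrite !divn_div ?expn_gt0 // expn_pow.
by rewrite -!PeanoNat.Nat.shiftr_div_pow2 PeanoNat.Nat.shiftr_lxor.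
Qed.

(** Reduction modulo [2 ^ m] keeps the bits below position [m] and clears the others, so both sides
    agree bit by bit. *)
Lemma lxor_modn_exp2 (m : nat) :
  {morph (fun k : nat => k %% 2 ^ m)%N : a b / PeanoNat.Nat.lxor a b}.
Proof.
move=> a b; rewrite !modn_modulo ?expn_gt0 // expn_pow.
apply: PeanoNat.Nat.bits_inj => i; rewrite PeanoNat.Nat.lxor_spec.
have [/ltP lt_im|/leP le_mi] := ltnP i m.
  by rewrite !PeanoNat.Nat.mod_pow2_bits_low // PeanoNat.Nat.lxor_spec.
by rewrite !PeanoNat.Nat.mod_pow2_bits_high.
Qed.

Lemma nimsum_map (n : nat) (f : nat -> nat) (x : 'rV[nat]_n) :
  {morph f : a b / PeanoNat.Nat.lxor a b} -> f 0%N = 0%N ->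
  nimsum (map_mx f x) = f (nimsum x).
Proof.
move=> fM f0; rewrite /nimsum (big_morph f fM f0).
by apply: eq_bigr => i _; rewrite mxE.
Qed.

(** A number vanishes exactly when its quotient and its remainder by [2 ^ m] do; this is applied to
    the Nim-sum itself. *)
Lemma nimsum_eq0_split (n m : nat) (x : 'rV[nat]_n) :
  nimsum x = 0%N <->
  nimsum (map_mx (fun k => k %/ 2 ^ m)%N x) = 0%N /\
  nimsum (map_mx (fun k => k %% 2 ^ m)%N x) = 0%N.
Proof.
rewrite (nimsum_map _ _ _ (lxor_divn_exp2 m)) ?div0n //.
rewrite (nimsum_map _ _ _ (lxor_modn_exp2 m)) ?mod0n //.
split=> [->|[q0 r0]]; first by rewrite div0n mod0n.
by rewrite (divn_eq (nimsum x) (2 ^ m)) q0 r0.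
Qed.

(** Covers the level [m = 0] of the union, which [ppos_split] does not reach: entries below [2 ^ 0]
    are zero. *)
Lemma ppos0_tset (n : nat) : ppos n 0 `<=` tset n.
Proof.
move=> x [x_lt1 x0]; split=> // i; left.
by have := x_lt1 i; rewrite expn0; case: (x _ _).
Qed.

Lemma ppos_split (n m : nat) (x : 'rV[nat]_n) :
  ppos n m.+1 x <->
  tset n (map_mx (fun k => k %/ 2 ^ m)%N x) /\
  ppos n m (map_mx (fun k => k %% 2 ^ m)%N x).
Proof.
have p_gt0 : (0 < 2 ^ m)%N by rewrite expn_gt0.
split=> [[x_lt /(nimsum_eq0_split _ m)[q0 r0]]|[[q_le q0] [_ r0]]].
  split; split=> // i; rewrite mxE ?ltn_mod //.
  have : (x ord0 i %/ 2 ^ m < 2)%N by rewrite ltn_divLR // -expnS.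
  by case: (_ %/ _)%N => [|[|]] //; [left|right].
split; last exact/(nimsum_eq0_split _ m).
move=> i; rewrite expnS -ltn_divLR //.
by have := q_le i; rewrite mxE => -[] ->.
Qed.

(** Division with remainder, [x = 2 ^ m * q + r] in each coordinate, divided by [2 ^ m.+1]. *)
Lemma scaled_natmx_split (R : realType) (n m : nat) (x : 'rV[nat]_n) :
  (1 / 2 ^+ m.+1) *: natmx R x =
  (1 / 2) *: (natmx R (map_mx (fun k => k %/ 2 ^ m)%N x) +
    (1 / 2 ^+ m) *: natmx R (map_mx (fun k => k %% 2 ^ m)%N x)).
Proof.
apply/rowP => i; rewrite !mxE {1}(divn_eq (x ord0 i) (2 ^ m)).
rewrite natrD natrM natrX exprS.
by field; rewrite expf_neq0 // Num.Theory.pnatr_eq0.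
Qed.

Theorem theorem4 (R : realType) (n : nat) (hodd : odd n) (hn : (3 <= n)%N) :
  plim R n =
  \bigcup_(v in tset n) scaled_translate (1 / 2) (natmx R v) (plim R n).
Proof.
apply/seteqP; split=> [_ [[|m] _ [x Px <-]]|_ [v Tv [_ [m _ [y Py <-]] <-]]].
- (* [x = 0] serves both as the translation vector and as the point. *)
  exists x; first exact: ppos0_tset.
  exists ((1 / 2 ^+ 0) *: natmx R x); first by exists 0%N => //; exists x.
  by apply/rowP => i; rewrite !mxE expr0; field.
- have [Tq Pr] := (ppos_split _ _ _).1 Px.
  rewrite scaled_natmx_split; eexists; first exact: Tq.
  by eexists => //; exists m => //; eexists; first exact: Pr.
(* Prepend the bit [v] to the [m]-bit number [y] in each coordinate; as [y < 2 ^ m], quotient and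
   remainder give back [v] and [y]. *)
- pose x : 'rV[nat]_n := \row_i (v ord0 i * 2 ^ m + y ord0 i)%N.
  have p_gt0 : (0 < 2 ^ m)%N by rewrite expn_gt0.
  have xq : map_mx (fun k => k %/ 2 ^ m)%N x = v.
    apply/rowP => i.
    by rewrite !mxE divnMDl // divn_small ?addn0 //; apply: Py.1.
  have xr : map_mx (fun k => k %% 2 ^ m)%N x = y.
    by apply/rowP => i; rewrite !mxE modnMDl modn_small //; apply: Py.1.
  exists m.+1 => //; exists x; first by apply/ppos_split; rewrite xq xr.
  by rewrite scaled_natmx_split xq xr.
Qed.
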